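(* Let $d$ and $\partial$ be uniformly locally finite metrics on $\mathbb{N}$, and let $E$ and $F$ be Banach spaces with symmetric bases $\mathcal{E}$ and $\mathcal{F}$, respectively. Suppose that $\mathrm{B}_u(d,\mathcal{E})$ and $\mathrm{B}_u(\partial,\mathcal{F})$ are simultaneously order and Banach algebra isomorphic, i.e., there is a Banach algebra isomorphism $\Phi:\mathrm{B}_u(d,\mathcal{E})\to\mathrm{B}_u(\partial,\mathcal{F})$ which is also an order isomorphism. Then $(\mathbb{N},d)$ and $(\mathbb{N},\partial)$ are bijectively coarsely equivalent.
   Context: All Banach spaces are complex, and ''basis'' means Schauder basis. For a basis $\mathcal{E}=(e_n)_n$ of $E$, $(e_n^* )_n$ denotes the biorthogonal functionals and $\mathcal{L}(E)$ the bounded operators on $E$. Given a metric $d$ on $\mathbb{N}$, $a\in\mathcal{L}(E)$ is a band operator (with respect to $\mathcal{E}$ and $d$) if there is $r>0$ such that $e_m^*(ae_n)=0$ whenever $d(n,m)>r$. $\mathrm{B}_u[d,\mathcal{E}]$ is the algebra of band operators, and the uniform Roe algebra $\mathrm{B}_u(d,\mathcal{E})$ is its operator-norm closure in $\mathcal{L}(E)$. A Banach algebra isomorphism is a bijective algebra homomorphism that is bounded with bounded inverse (not necessarily isometric). A metric $d$ on $\mathbb{N}$ is uniformly locally finite if $\sup_{x\in\mathbb{N}}|B_r(x)|<\infty$ for all $r>0$, where $B_r(x)$ is the closed ball of radius $r$ about $x$. Order: $E_+=\{\sum_n a_ne_n\in E: a_n\ge 0\ \forall n\}$; $a\in\mathcal{L}(E)$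 is positive if $a(E_+)\subset E_+$, and $a\le b$ means $b-a$ is positive. $\mathrm{B}_u(d,\mathcal{E})$ carries the order inherited from $\mathcal{L}(E)$. A linear map between ordered Banach spaces is positive if it sends positive elements to positive elements, and is an order isomorphism if it is a positive bijection whose inverse is positive. Two sequences $(x_n)_n,(y_n)_n$ are $\lambda$-equivalent ($\lambda\ge1$) if $\lambda^{-1}\|\sum_{n\le k}\alpha_nx_n\|\le\|\sum_{n\le k}\alpha_ny_n\|\le\lambda\|\sum_{n\le k}\alpha_nx_n\|$ for all $k$ and all scalars, and equivalent if they are $\lambda$-equivalent for some $\lambda$. A basis $(e_n)_n$ is symmetric if it is equivalent to $(e_{\pi(n)})_n$ for all bijections $\pi:\mathbb{N}\to\mathbb{N}$. A map $f:(X,d)\to(Y,\partial)$ is coarse if for all $r>0$ there is $s>0$ such that $d(x,y)<r$ implies $\partial(f(x),f(y))<s$; expanding if for all $s>0$ there is $r>0$ such that $d(x,y)>r$ implies $\partial(f(x),f(y))>s$; a coarse embedding if it is both coarse and expanding; a coarse equivalence if moreover $\sup_{y\in Y}\partial(y,f(X))<\infty$. Two spaces are bijectively coarsely equivalent if there is a bijective coarse equivalence between them. *)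

(* Defs.v *)
From HB Require Import structures.
From mathcomp Require Import all_boot all_order all_algebra.
From mathcomp Require Import all_classical all_reals all_analysis.
From mathcomp Require Export complex.

Set Implicit Arguments.
Unset Strict Implicit.
Unset Printing Implicit Defensive.

Import Order.TTheory GRing.Theory Num.Theory.
Import numFieldNormedType.Exports.

Local Open Scope classical_set_scope.
Local Open Scope ring_scope.
Local Open Scope complex_scope.
Local Open Scope card_scope.

Section Coarse.
Variable R : realType.

Definition is_metric (T : Type) (d : T -> T -> R) : Prop :=
  [/\ forall x y, 0 <= d x y,
      forall x y, d x y = 0 <-> x = y,
      forall x y, d x y = d y x &
      forall x y z, d x z <= d x y + d y z].

Definition uniformly_locally_finite (T : Type) (d : T -> T -> R) : Prop :=
  forall r : R, 0 < r ->
    exists N : nat, forall x, [set y | d x y <= r] #<= `I_N.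

Variables (T U : Type) (dT : T -> T -> R) (dU : U -> U -> R).

Definition coarse (f : T -> U) : Prop :=
  forall r : R, 0 < r -> exists2 s : R, 0 < s &
    forall x y, dT x y < r -> dU (f x) (f y) < s.

Definition expanding (f : T -> U) : Prop :=
  forall s : R, 0 < s -> exists2 r : R, 0 < r &
    forall x y, r < dT x y -> s < dU (f x) (f y).

Definition coarse_embedding (f : T -> U) : Prop := coarse f /\ expanding f.

Definition coarse_equivalence (f : T -> U) : Prop :=
  coarse_embedding f /\
  has_ubound (range (fun y => inf (range (fun x => dU y (f x))))).

Definition bijectively_coarsely_equivalent : Prop :=
  exists2 f : T -> U, bijective f & coarse_equivalence f.

End Coarse.

Section Bases.
Variables (R : realType) (E : completeNormedModType R[i]).
Implicit Types (e x y : nat -> E).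

Definition expansion e (v : E) : set (nat -> R[i]) :=
  [set c | series (fun n => c n *: e n) @ \oo --> v].

Definition schauder_basis e : Prop :=
  forall v : E, exists! c : nat -> R[i], expansion e v c.

(* [coord e n] is the biorthogonal functional e_n^* when [e] is a basis. *)
Definition coord e (n : nat) (v : E) : R[i] := xget (fun=> 0) (expansion e v) n.

Definition lambda_equivalent (lambda : R) x y : Prop :=
  forall (k : nat) (c : nat -> R[i]),
    (lambda^-1)%:C * `|\sum_(n < k.+1) c n *: x n|
      <= `|\sum_(n < k.+1) c n *: y n|
      <= lambda%:C * `|\sum_(n < k.+1) c n *: x n|.

Definition equivalent_seq x y : Prop :=
  exists2 lambda : R, 1 <= lambda & lambda_equivalent lambda x y.

Definition symmetric_basis e : Prop :=
  schauder_basis e /\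
  forall pi : nat -> nat, bijective pi -> equivalent_seq e (e \o pi).

(* In the order of R[i], 0 <= z means that z is real and nonnegative. *)
Definition positive_cone e : set E :=
  [set v | exists2 c : nat -> R[i], (forall n, 0 <= c n) & expansion e v c].

End Bases.

(* Operators are plain functions E -> E, with the pointwise vector space
   structure and composition as product. *)
Section Operators.
Variables (R : realType) (E : completeNormedModType R[i]).
Implicit Types (a b : E -> E) (e : nat -> E) (d : nat -> nat -> R).

Definition bounded_operators : set (E -> E) :=
  [set a | linear a /\ continuous a].

Definition opnorm a : R :=
  inf [set M : R | 0 <= M /\ forall v, `|a v| <= M%:C * `|v|].

Definition positive_operator e a : Prop :=
  forall v, positive_cone e v -> positive_cone e (a v).

Definition band_operators d e : set (E -> E) :=
  [set a | bounded_operators a /\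
    exists2 r : R, 0 < r &
      forall n m, r < d n m -> coord e m (a (e n)) = 0].

Definition uniform_roe_algebra d e : set (E -> E) :=
  [set a | bounded_operators a /\
    forall eps : R, 0 < eps ->
      exists2 b, band_operators d e b & opnorm (a - b) < eps].

End Operators.

Section Isomorphisms.
Variables (R : realType) (E F : completeNormedModType R[i]).
Implicit Types (A : set (E -> E)) (B : set (F -> F)).
Implicit Types (Phi : (E -> E) -> (F -> F)).

Definition algebra_hom_on A Phi : Prop :=
  (forall (c : R[i]) a b, A a -> A b -> Phi (c *: a + b) = c *: Phi a + Phi b) /\
  (forall a b, A a -> A b -> Phi (a \o b) = Phi a \o Phi b).

Definition bounded_on A Phi : Prop :=
  exists C : R, forall a, A a -> opnorm (Phi a) <= C * opnorm a.

Definition positive_on (e : nat -> E) (f : nat -> F) A Phi : Prop :=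
  forall a, A a -> positive_operator e a -> positive_operator f (Phi a).

End Isomorphisms.

(* A map between algebras of operators is given by a function on all of
   E -> E whose values outside of [A] are irrelevant; ['pinv_(fun=> 0) A Phi]
   is the inverse of the bijection from [A] to [B] it induces. *)
Definition banach_algebra_iso (R : realType) (E F : completeNormedModType R[i])
    (A : set (E -> E)) (B : set (F -> F)) (Phi : (E -> E) -> (F -> F)) : Prop :=
  [/\ set_bij A B Phi, algebra_hom_on A Phi, bounded_on A Phi &
      bounded_on B ('pinv_(fun=> 0) A Phi)].

Definition order_iso (R : realType) (E F : completeNormedModType R[i])
    (e : nat -> E) (f : nat -> F)
    (A : set (E -> E)) (B : set (F -> F)) (Phi : (E -> E) -> (F -> F)) : Prop :=
  [/\ set_bij A B Phi, positive_on e f A Phi &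
      positive_on f e B ('pinv_(fun=> 0) A Phi)].

(* Main.v *)
Require Import Defs.
From HB Require Import structures.
From mathcomp Require Import all_boot all_order all_algebra.
From mathcomp Require Import all_classical all_reals all_analysis complex.
From mathcomp Require Import ring lra.

(* The isomorphism Phi fixes the identity and preserves the order, so it
   sends each coordinate projection p_n to an operator between 0 and 1;
   such an operator is diagonal, and applying the same to the inverse of Phi
   shows that Phi(p_n) is again a coordinate projection p'_(s n), for a
   bijection s. If s were not coarse, there would be an involution of the
   integers moving points by a bounded distance whose image under s moves
   points arbitrarily far. By symmetry of the basis it induces a band
   operator a. The blocks p_y a p_x with y the partner of x have norms
   bounded below, and so do their images p'_(s y) Phi(a) p'_(s x); this
   contradicts the approximability of Phi(a) by band operators. Exchanging
   the roles of Phi and its inverse shows that s^-1 is coarse too.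

   The continuity of the coordinates of a Schauder basis, and the uniform
   bound on the partial sums, come from a Baire category argument on the sets
   where all partial sums are bounded by n, followed by successive
   approximation as in the open mapping theorem. *)

Set Implicit Arguments.
Unset Strict Implicit.
Unset Printing Implicit Defensive.

Import Order.TTheory GRing.Theory Num.Theory.
Import numFieldNormedType.Exports.

Local Open Scope classical_set_scope.
Local Open Scope ring_scope.
Local Open Scope complex_scope.

Local Notation Re := complex.Re.
Local Notation Im := complex.Im.
Local Notation coord := Defs.coord.

(** * Real-valued norms and completeness *)

Section RealNorm.
Variable R : realType.

(** The norm is [R[i]]-valued but real; its real part lives in a totally ordered field. *)
Definition nrm (V : normedModType R[i]) (v : V) : R := Re `|v|.

Lemma normE (V : normedModType R[i]) (v : V) : `|v| = (nrm v)%:C.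
Proof. by rewrite /nrm RRe_real// normr_real. Qed.

Section Norm.
Variable V : normedModType R[i].
Implicit Types (u v w : V) (x : nat -> V).

Lemma nrm_ge0 v : 0 <= nrm v.
Proof. by rewrite -ler0c -normE. Qed.

Lemma nrm0 : nrm (0 : V) = 0.
Proof. by rewrite /nrm normr0. Qed.

Lemma nrm_eq0 v : nrm v = 0 -> v = 0.
Proof. by move=> v0; apply/normr0_eq0; rewrite normE v0. Qed.

Lemma nrm_gt0 v : v <> 0 -> 0 < nrm v.
Proof. by move=> v0; rewrite lt_def nrm_ge0 andbT; apply/eqP => /nrm_eq0. Qed.

Lemma nrmD u v : nrm (u + v) <= nrm u + nrm v.
Proof. by rewrite -lecR rmorphD/= -!normE ler_normD. Qed.

Lemma nrmN v : nrm (- v) = nrm v.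
Proof. by rewrite /nrm normrN. Qed.

Lemma nrmB u v : nrm (u - v) <= nrm u + nrm v.
Proof. by rewrite -(nrmN v) nrmD. Qed.

Lemma nrm_distC u v : nrm (u - v) = nrm (v - u).
Proof. by rewrite -nrmN opprB. Qed.

Lemma nrm_triangle v u w : nrm (u - w) <= nrm (u - v) + nrm (v - w).
Proof. by apply: le_trans (nrmD _ _); rewrite addrA subrK. Qed.

Lemma nrmZ (c : R[i]) v : nrm (c *: v) = nrm (c : R[i]^o) * nrm v.
Proof.
by apply: complexI; rewrite rmorphM/= -!normE normrZ.
Qed.

Lemma cvg_nrmP x v : x @ \oo --> v <->
  forall eps : R, 0 < eps ->
    exists N, forall n, (N <= n)%N -> nrm (v - x n) < eps.
Proof.
split=> [/cvgrPdist_lt xv eps eps0|xv].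
  have [|N _ Nv] := xv eps%:C; first by rewrite ltcR.
  by exists N => n /Nv /=; rewrite normE ltcR.
apply/cvgrPdist_lt => eps eps0.
have epsE : eps = (Re eps)%:C by rewrite RRe_real// gtr0_real.
have [|N Nv] := xv (Re eps); first by rewrite -ltcR -epsE.
by exists N => // n /= /Nv; rewrite normE epsE ltcR.
Qed.

Lemma nrm_le_cvg x v w (B : R) : x @ \oo --> v ->
  (forall n, nrm (w - x n) <= B) -> nrm (w - v) <= B.
Proof.
move=> /cvg_nrmP xv xB; apply/ler_addgt0Pr => eps /xv[N /(_ N (leqnn N)) vN].
by have := nrm_triangle (x N) w v; rewrite (nrm_distC (x N)); have := xB N; lra.
Qed.

Lemma cvg_uniq x v w : x @ \oo --> v -> x @ \oo --> w -> v = w.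
Proof. by move=> xv xw; apply: cvg_unique xw. Qed.

End Norm.

(** Real and imaginary parts are additive and 1-Lipschitz, so each gives a Cauchy sequence in
    [R]. *)
Lemma nrm_scalar_cauchy (u : nat -> R[i]^o) :
  (forall eps : R, 0 < eps -> exists N, forall p q,
    (N <= p)%N -> (N <= q)%N -> nrm (u p - u q) < eps) ->
  exists l : R[i]^o, u @ \oo --> l.
Proof.
move=> uC.
have part (h : R[i] -> R) :
    (forall a b, h (a - b) = h a - h b) -> (forall a, `|h a| <= nrm (a : R[i]^o)) ->
    exists l : R, forall eps, 0 < eps ->
      exists N, forall n, (N <= n)%N -> `|l - h (u n)| < eps.
  move=> hB hle; have : cvg (h (u n) @[n --> \oo]).
    apply/cauchy_cvgP/cauchy_exP => eps eps0.
    have [N NC] := uC _ eps0.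
    exists (h (u N)); exists N => // n /= Nn; rewrite /ball/= -hB.
    by apply: le_lt_trans (hle _) (NC _ _ _ Nn).
  move=> /cvg_ex[l /cvgrPdist_lt lh]; exists l => eps /lh[N _ NP].
  by exists N => n /NP.
have Rele (a : R[i]) : `|Re a| <= nrm (a : R[i]^o).
  by rewrite -lecR -normE normc_ge_Re.
(* Up to sign, [Im a] is the real part of [a] times the imaginary unit, which has norm 1. *)
have Imle (a : R[i]) : `|Im a| <= nrm (a : R[i]^o).
  have := Rele ('i%C * a); rewrite mulrC ReiNIm normrN => /le_trans; apply.
  by rewrite mulrC (nrmZ ('i%C) (a : R[i]^o)) /nrm normc_def /= expr0n expr1n add0r sqrtr1 mul1r.
have [||a aP] := part (@Re R); [by move=> [? ?] [? ?]|by []|].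
have [||b bP] := part (@Im R); [by move=> [? ?] [? ?]|by []|].
exists ((a +i* b) : R[i]^o); apply/cvg_nrmP => eps eps0.
have e2 : 0 < eps / 2 by lra.
have [N1 N1P] := aP _ e2; have [N2 N2P] := bP _ e2.
exists (maxn N1 N2) => n; rewrite geq_max => /andP[/N1P+ /N2P].
case: (u n) => p q /= ap bq.
have -> : ((a +i* b) - (p +i* q) : R[i]^o) = (a - p)%:C + 'i%C * (b - q)%:C.
  by simpc.
have nC (t : R) : nrm (t%:C : R[i]^o) = `|t|.
  by rewrite /nrm normc_def /= expr0n addr0 sqrtr_sqr.
apply: le_lt_trans (nrmD _ _) _.
rewrite (nrmZ ('i%C) ((b - q)%:C : R[i]^o)) !nC.
rewrite {1}/nrm normc_def /= expr0n expr1n add0r sqrtr1 mul1r; lra.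
Qed.

Lemma nrm_cauchy (E : completeNormedModType R[i]) (x : nat -> E) :
  (forall eps : R, 0 < eps -> exists N, forall p q,
    (N <= p)%N -> (N <= q)%N -> nrm (x p - x q) < eps) ->
  exists v : E, x @ \oo --> v.
Proof.
move=> xC; apply/cvg_ex.
apply: cauchy_cvg; apply: cauchy_exP => eps eps0.
have epsE : eps = (Re eps)%:C by rewrite RRe_real// gtr0_real.
have [|N NC] := xC (Re eps); first by rewrite -ltcR -epsE.
exists (x N); exists N => // n /= Nn.
by rewrite -ball_normE /= normE epsE ltcR; apply: NC.
Qed.

End RealNorm.

(** * Continuity of the coordinates of a Schauder basis *)

Section Baire.
Variable R : realType.

Lemma geometric_small (B eps : R) : 0 < eps -> exists N, B * (2^-1) ^+ N < eps.
Proof.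
move=> eps0; have : geometric B (2^-1) @ \oo --> (0 : R).
  by apply: cvg_geometric; rewrite ger0_norm ?invr_ge0//; lra.
move=> /cvgrPdist_lt/(_ _ eps0)[N _ /(_ N (leqnn N))] /=.
by rewrite sub0r normrN => /(le_lt_trans (ler_norm _)) lt; exists N.
Qed.

Variable E : completeNormedModType R[i].

(** Nested closed balls: ball [n.+1] lies in ball [n], misses [A n] and has at most half its radius,
    so the centres converge to a point of every ball. *)
Lemma Baire_nowhere_dense (A : nat -> set E) :
  (forall n x (del : R), 0 < del -> exists y, exists eps : R,
     [/\ 0 < eps, nrm (y - x) < del & forall z, nrm (z - y) < eps -> ~ A n z]) ->
  exists x, forall n, ~ A n x.
Proof.
move=> nd.
have step (p : nat * (E * R)) : exists q : E * R, 0 < p.2.2 ->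
    [/\ 0 < q.2, nrm (q.1 - p.2.1) + q.2 <= p.2.2, q.2 <= p.2.2 / 2
      & forall z, nrm (z - q.1) <= q.2 -> ~ A p.1 z].
  case: p => n [x del] /=; have [del0|] := ltP 0 del; last by exists (x, 0).
  have [|y [eps [eps0 yx yA]]] := nd n x (del / 2); first by lra.
  (* Radius at most [eps / 2] makes the closed ball miss [A n]; as the centre moved by less than
     [del / 2], radius at most [del / 2] keeps it inside the old ball. *)
  exists (y, Num.min (eps / 2) (del / 2)) => /= _; split.
  - by rewrite lt_min; apply/andP; split; lra.
  - have : Num.min (eps / 2) (del / 2) <= del / 2 by rewrite ge_min lexx orbT.
    by lra.
  - by rewrite ge_min lexx orbT.
  - move=> z zy; apply: yA; apply: le_lt_trans zy _.
    have : Num.min (eps / 2) (del / 2) <= eps / 2 by rewrite ge_min lexx.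
    by lra.
have [g gP] := choice step.
pose s := fix s n := if n is m.+1 then g (m, s m) else ((0 : E), (1 : R)).
have s0 n : 0 < (s n).2.
  by elim: n => [|n IH] /=; [exact: ltr01 | have [] := gP (n, s n) IH].
have sS n : [/\ 0 < (s n.+1).2, nrm ((s n.+1).1 - (s n).1) + (s n.+1).2 <= (s n).2,
    (s n.+1).2 <= (s n).2 / 2 & forall z, nrm (z - (s n.+1).1) <= (s n.+1).2 -> ~ A n z].
  exact: (gP (n, s n) (s0 n)).
have sle n k : nrm ((s (k + n)%N).1 - (s n).1) + (s (k + n)%N).2 <= (s n).2.
  elim: k => [|k IH]; first by rewrite subrr nrm0 add0r.
  have [_ S1 _ _] := sS (k + n)%N.
  by have := nrm_triangle (s (k + n)%N).1 (s (k + n).+1).1 (s n).1; rewrite addSn; lra.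
have s2 n : (s n).2 <= 1 * (2^-1) ^+ n.
  elim: n => [|n IH]; first by rewrite expr0 mulr1.
  by have [_ _ S2 _] := sS n; rewrite exprS; lra.
have [|x xP] := @nrm_cauchy R E (fun n => (s n).1).
  move=> eps eps0; have [|N NP] := @geometric_small 1 (eps / 2); first by lra.
  exists N => p q Np Nq.
  have := sle N (p - N)%N; have := sle N (q - N)%N; rewrite !subnK//.
  have := nrm_triangle (s N).1 (s p).1 (s q).1; rewrite (nrm_distC (s N).1).
  by have := s2 N; have := s0 p; have := s0 q; lra.
exists x => n; have [_ _ _] := sS n; apply.
rewrite nrm_distC; apply: (@nrm_le_cvg _ _ (fun k => (s (k + n.+1)%N).1)).
  by move: xP; rewrite -(@cvg_shiftn n.+1 _ (fun k => (s k).1)).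
move=> k; rewrite nrm_distC; have := sle n.+1 k; have := s0 (k + n.+1)%N; lra.
Qed.

End Baire.

(** * Coordinate functionals and partial sums *)

Section Basis.
Variables (R : realType) (E : completeNormedModType R[i]) (e : nat -> E).
Hypothesis basis : schauder_basis e.

Definition psum n (v : E) : E := \sum_(0 <= k < n) coord e k v *: e k.

Lemma coordP v : psum ^~ v @ \oo --> v.
Proof.
have [c [cv _]] := basis v.
by have := xgetPex (fun=> 0) (ex_intro _ c cv).
Qed.

Lemma coord_unique v (c : nat -> R[i]) n :
  (fun m => \sum_(0 <= k < m) c k *: e k) @ \oo --> v -> coord e n v = c n.
Proof.
move=> cv; have [c' [_ c'P]] := basis v.
by rewrite -(c'P _ cv) (c'P (coord e ^~ v) (@coordP v)).
Qed.

Lemma coord_linear n : linear (coord e n : E -> R[i]^o).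
Proof.
move=> a u v; apply: (@coord_unique _ (fun k => a * coord e k u + coord e k v)).
have -> : (fun m => \sum_(0 <= k < m) (a * coord e k u + coord e k v) *: e k)
    = (fun m => a *: psum m u + psum m v).
  apply/funext => m; rewrite scaler_sumr -big_split /=.
  by apply: eq_bigr => k _; rewrite scalerDl scalerA.
by apply: cvgD; [apply: cvgZl_tmp|]; exact: coordP.
Qed.

Lemma coord0 n : coord e n 0 = 0.
Proof.
apply: (@coord_unique _ (fun=> 0)).
rewrite (_ : (fun _ => _) = cst 0); first exact: cvg_cst.
by apply/funext => m; rewrite big1// => k _; rewrite scale0r.
Qed.

Lemma coordZ n a v : coord e n (a *: v) = a * coord e n v.
Proof. by have := coord_linear n a v 0; rewrite addr0 coord0 addr0. Qed.

Lemma coordD n u v : coord e n (u + v) = coord e n u + coord e n v.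
Proof. by have := coord_linear n 1 u v; rewrite !scale1r. Qed.

Lemma coordN n v : coord e n (- v) = - coord e n v.
Proof. by rewrite -scaleN1r coordZ mulN1r. Qed.

Lemma coordB n u v : coord e n (u - v) = coord e n u - coord e n v.
Proof. by rewrite coordD coordN. Qed.

Lemma sum_delta (u : nat -> E) (m n : nat) : (m < n)%N ->
  \sum_(0 <= k < n) (k == m)%:R *: u k = u m.
Proof.
move=> mn; rewrite big_mkord (bigD1 (Ordinal mn))//= eqxx scale1r big1 ?addr0//.
by move=> i /negPf; rewrite -val_eqE /= => ->; rewrite scale0r.
Qed.

Lemma coord_basis n m : coord e n (e m) = (n == m)%:R.
Proof.
apply: (@coord_unique _ (fun n => (n == m)%:R)).
apply/cvg_nrmP => eps eps0; exists m.+1 => k mk.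
by rewrite sum_delta// subrr nrm0.
Qed.

Lemma basis_neq0 n : e n <> 0.
Proof.
move=> en0; have := coord_basis n n; rewrite en0 coord0 eqxx.
by move/eqP; rewrite eq_sym oner_eq0.
Qed.

Lemma psum0 n : psum n 0 = 0.
Proof. by rewrite /psum big1// => k _; rewrite coord0 scale0r. Qed.

Lemma psum_linear n : linear (psum n).
Proof.
move=> a u v; rewrite /psum scaler_sumr -big_split /=.
by apply: eq_bigr => k _; rewrite coordD coordZ scalerDl scalerA.
Qed.

Lemma psumD n u v : psum n (u + v) = psum n u + psum n v.
Proof. by have := psum_linear n 1 u v; rewrite !scale1r. Qed.

Lemma psumZ n a u : psum n (a *: u) = a *: psum n u.
Proof. by have := psum_linear n a u 0; rewrite addr0 psum0 addr0. Qed.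

Lemma psumB n u v : psum n (u - v) = psum n u - psum n v.
Proof. by rewrite psumD -scaleN1r psumZ scaleN1r. Qed.

Lemma psumN n u : psum n (- u) = - psum n u.
Proof. by rewrite -scaleN1r psumZ scaleN1r. Qed.

Lemma psum_nil v : psum 0 v = 0.
Proof. by rewrite /psum big_nil. Qed.

Lemma psumS n v : psum n.+1 v = psum n v + coord e n v *: e n.
Proof. by rewrite /psum big_nat_recr. Qed.

(** The bound depends on [v]; being a natural number, it yields a countable cover of the space for
    the Baire argument. *)
Lemma psum_bounded v : exists N : nat, forall n, nrm (psum n v) <= N%:R.
Proof.
have : cvgn (psum ^~ v) by apply/cvg_ex; exists v; exact: coordP.
move=> /cvg_seq_bounded /pinfty_ex_gt0[M M0 aM].
have ME : M = (Re M)%:C by rewrite RRe_real// gtr0_real.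
exists (Num.truncn (Re M)).+1 => n; apply: (@le_trans _ _ (Re M)).
  by rewrite -lecR -ME -normE; exact: aM.
by rewrite ltW// truncnS_gt.
Qed.

End Basis.

(** * Uniform boundedness of the partial sums *)

Section BasisConstant.
Variables (R : realType) (E : completeNormedModType R[i]) (e : nat -> E).
Hypothesis basis : schauder_basis e.
Local Notation psum := (psum e).

Lemma nrmZ_ge0 (t : R) (v : E) : 0 <= t -> nrm (t%:C *: v) = t * nrm v.
Proof.
move=> t0; apply: complexI.
by rewrite rmorphM/= -!normE normrZ ger0_norm// ler0c.
Qed.

Lemma coord_nrm n v : nrm (coord e n v *: e n) <= nrm (psum n.+1 v) + nrm (psum n v).
Proof.
have := nrmB (psum n v + coord e n v *: e n) (psum n v).
by rewrite psumS addrAC subrr add0r.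
Qed.

(* The coordinates of [r 0 - r K] converge to scalars [c n] whose series
   converges to [r 0]; by uniqueness they are the coordinates of [r 0]. *)
Lemma psum_le_telescope (r : nat -> E) (B C : R) :
  (forall P j m, nrm (psum m (r P - r (P + j)%N)) <= B * (2^-1) ^+ P) ->
  (forall P, nrm (r P) <= C * (2^-1) ^+ P) ->
  forall m, nrm (psum m (r 0%N)) <= B.
Proof.
move=> rB rC.
have /choice[c cP] n : exists l : R[i]^o,
    (fun K => coord e n (r 0%N - r K) : R[i]^o) @ \oo --> l.
  apply: nrm_scalar_cauchy => eps eps0; have en0 := nrm_gt0 (@basis_neq0 _ _ _ basis n).
  have [N NP] := @geometric_small _ (4 * B) (eps * nrm (e n)) (mulr_gt0 eps0 en0).
  have coordN p : (N <= p)%N -> nrm (coord e n (r N - r p) *: e n) <= 2 * (B * (2^-1) ^+ N).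
    move=> Np; have := coord_nrm n (r N - r p).
    have := rB N (p - N)%N n; have := rB N (p - N)%N n.+1; rewrite subnKC//.
    by lra.
  exists N => p q Np Nq; rewrite -(ltr_pM2r en0) -nrmZ -coordB//.
  have -> : r 0%N - r p - (r 0%N - r q) = (r N - r p) - (r N - r q).
    by rewrite !opprB [LHS]addrC [RHS]addrC !subrKA.
  rewrite coordB// scalerBl; apply: le_lt_trans (nrmB _ _) _.
  by have := coordN _ Np; have := coordN _ Nq; lra.
pose T m := \sum_(0 <= k < m) c k *: e k.
have Tlim m : (fun K => psum m (r 0%N - r K)) @ \oo --> T m.
  elim: m => [|m IH].
    rewrite /T big_nil (_ : (fun _ => _) = cst 0); first exact: cvg_cst.
    by apply/funext => K; rewrite psum_nil.
  rewrite /T big_nat_recr//=.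
  rewrite (_ : (fun _ => _) = (fun K => psum m (r 0%N - r K) + coord e m (r 0%N - r K) *: e m)).
    by apply: cvgD => //; apply: cvgZr_tmp; exact: cP.
  by apply/funext => K; rewrite psumS.
(* The difference is the limit in [Q] of [psum m (r K - r (K + Q))]. The bound is uniform in [m],
   which permits exchanging the limits in [m] and [K]. *)
have TB m K : nrm (T m - psum m (r 0%N - r K)) <= B * (2^-1) ^+ K.
  rewrite nrm_distC; apply: (@nrm_le_cvg _ _ (fun Q => psum m (r 0%N - r (Q + K)%N))).
    by move: (Tlim m); rewrite -(@cvg_shiftn K _ (fun Q => psum m (r 0%N - r Q))).
  move=> Q; rewrite -psumB// -nrmN -psumN//.
  rewrite (_ : - _ = r K - r (K + Q)%N) //.
  by rewrite opprB opprB [LHS]addrC subrKA [(Q + K)%N]addnC.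
have Tr : T @ \oo --> r 0%N.
  apply/cvg_nrmP => eps eps0.
  have [|K KP] := @geometric_small _ (B + C) (eps / 2); first by lra.
  have /cvg_nrmP/(_ (eps / 2))[|M MP] := @coordP _ _ _ basis (r 0%N - r K); first by lra.
  exists M => m /MP mP.
  have := TB m K; have := rC K.
  have := nrm_triangle (psum m (r 0%N - r K)) (r 0%N) (T m).
  have := nrm_triangle (r 0%N - r K) (r 0%N) (psum m (r 0%N - r K)).
  rewrite subKr (nrm_distC (psum m _) (T m)).
  by lra.
move=> m; have := TB m 0%N; rewrite subrr psum0// subr0 expr0 mulr1.
suff -> : psum m (r 0%N) = T m by [].
by apply: eq_bigr => k _; rewrite (coord_unique basis k Tr).
Qed.

(** By Baire, some [A n] is dense in a ball around a point [x]. For a small multiple [t y],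
    subtracting points of [A n] close to [x + t y] and to [x] approximates [t y]; then rescale by
    [t^-1]. *)
Lemma approx_bounded_psum : exists2 M : R, 0 <= M & forall y : E, exists z : E,
  nrm (y - z) <= nrm y / 2 /\ forall m, nrm (psum m z) <= M * nrm y.
Proof.
pose A (n : nat) : set E := [set x | forall m, nrm (psum m x) <= n%:R].
have [n [x [del [del0 H]]]] : exists n x, exists del : R, 0 < del /\
    forall y (eps : R), 0 < eps -> nrm (y - x) < del ->
      exists2 z, nrm (z - y) < eps & A n z.
  apply: contrapT => no; have [|x xA] := @Baire_nowhere_dense _ E A.
    move=> n x del del0; apply: contrapT => no'.
    apply: no; exists n, x, del; split => // y eps eps0 yx.
    apply: contrapT => no''; apply: no'; exists y, eps; split => // z zy Az.
    by apply: no''; exists z.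
  by have [N NP] := psum_bounded basis x; apply: (xA N).
have n0 : 0 <= n%:R :> R by [].
(* A difference of two points of [A n] has partial sums of norm at most [2 * n], and [t^-1] is
   [2 * nrm y / del]. *)
exists (4 * n%:R / del); first by apply: divr_ge0; [lra|exact: ltW].
move=> y; have [->|/eqP/nrm_gt0 y0] := eqVneq y 0.
  by exists 0; rewrite subrr nrm0; split=> [|m]; rewrite ?psum0// ?nrm0; lra.
pose t := (del / 2) / nrm y.
have t0 : 0 < t by rewrite /t divr_gt0//; lra.
have ty : nrm (t%:C *: y) = del / 2 by rewrite nrmZ_ge0 ?(ltW t0)// /t divfK// gt_eqF.
(* Two errors of [del / 8] add up to half of the norm [del / 2] of [t y]. *)
have [||z1 z1y Az1] := H (x + t%:C *: y) (del / 8); first by lra.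
  by rewrite addrAC subrr add0r ty; lra.
have [||z2 z2y Az2] := H x (del / 8); first by lra.
  by rewrite subrr nrm0.
have tV0 : 0 <= t^-1 by rewrite invr_ge0 ltW.
exists (t^-1%:C *: (z1 - z2)); split=> [|m]; last first.
  rewrite psumZ// nrmZ_ge0// psumB//.
  have -> : 4 * n%:R / del * nrm y = t^-1 * (2 * n%:R).
    by rewrite /t; field; rewrite !gt_eqF.
  rewrite ler_wpM2l//; apply: le_trans (nrmB _ _) _.
  by have := Az1 m; have := Az2 m; lra.
have -> : y - t^-1%:C *: (z1 - z2) = t^-1%:C *: ((t%:C *: y) - (z1 - z2)).
  rewrite [RHS]scalerBr scalerA -rmorphM mulVf ?gt_eqF//= ?scale1r//.
rewrite nrmZ_ge0// (_ : nrm y / 2 = t^-1 * (del / 4)); last first.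
  by rewrite /t; field; rewrite !gt_eqF.
rewrite ler_wpM2l//.
have -> : t%:C *: y - (z1 - z2) = (z2 - x) - (z1 - (x + t%:C *: y)).
  by rewrite !opprB !addrA subrK [z2 + _]addrC.
by have := nrmB (z2 - x) (z1 - (x + t%:C *: y)); lra.
Qed.

(** Subtracting approximants repeatedly halves the remainder [r K]; the partial sums of the removed
    pieces are dominated by a geometric series with sum [2 * M * nrm y]. *)
Lemma basis_constant : exists2 M : R, 0 <= M &
  forall m y, nrm (psum m y) <= M * nrm y.
Proof.
have [M M0 /choice[h hP]] := approx_bounded_psum.
exists (2 * M) => [|m y]; first lra.
pose r K := iter K (fun y => y - h y) y.
have rC P : nrm (r P) <= nrm y * (2^-1) ^+ P.
  elim: P => [|P IH]; first by rewrite expr0 mulr1.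
  by have [+ _] := hP (r P); rewrite /= -/(r P) exprS; lra.
apply: (@psum_le_telescope r (2 * M * nrm y) (nrm y)) => // P j {}m.
(* The exact value of the finite geometric sum is what the induction on [j] can carry. *)
suff : nrm (psum m (r P - r (P + j)%N)) <= 2 * M * nrm y * ((2^-1) ^+ P - (2^-1) ^+ (P + j)).
  have : 0 <= M * nrm y * (2^-1) ^+ (P + j).
    by rewrite !mulr_ge0 ?nrm_ge0 ?exprn_ge0 ?invr_ge0.
  by lra.
elim: j => [|j IH]; first by rewrite addn0 !subrr psum0// nrm0 mulr0.
have -> : r P - r (P + j.+1)%N = (r P - r (P + j)%N) + h (r (P + j)%N).
  by rewrite addnS /= -/(r (P + j)%N) opprB addrA addrAC.
rewrite psumD//; apply: le_trans (nrmD _ _) _.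
have [_ /(_ m)] := hP (r (P + j)%N).
have := ler_wpM2l M0 (rC (P + j)%N); rewrite addnS exprS; lra.
Qed.

End BasisConstant.

(** * Uniform Roe algebras *)

Section BoundedOperators.
Variables (R : realType) (E : completeNormedModType R[i]).
Implicit Types (a b : E -> E).

Lemma op0 a : linear a -> a 0 = 0.
Proof. by move=> la; have := la (-1) 0 0; rewrite !scaleN1r oppr0 addr0 addNr. Qed.

Lemma opD a : linear a -> {morph a : u v / u + v}.
Proof. by move=> la u v; have := la 1 u v; rewrite !scale1r. Qed.

Lemma opZ a : linear a -> forall (c : R[i]) v, a (c *: v) = c *: a v.
Proof. by move=> la c v; have := la c v 0; rewrite (op0 la)// !addr0. Qed.

Lemma opB a : linear a -> {morph a : u v / u - v}.
Proof. by move=> la u v; rewrite (opD la)// -scaleN1r (opZ la)// scaleN1r. Qed.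

Lemma bounded_operatorsP a : bounded_operators a <->
  linear a /\ exists2 M : R, 0 <= M & forall v, nrm (a v) <= M * nrm v.
Proof.
split=> -[la]; pose a' : {linear E -> E} := HB.pack a (GRing.isLinear.Build _ _ _ _ _ la).
  move=> ca; split => //.
  have /linear_boundedP/pinfty_ex_gt0[M M0 aM] : bounded_near a' (nbhs (0 : E)).
    exact/linear_bounded_continuous.
  have ME : M = (Re M)%:C by rewrite RRe_real// gtr0_real.
  exists (Re M) => [|v]; first by rewrite -ler0c -ME ltW.
  by rewrite -lecR rmorphM/= -!normE -ME; exact: aM.
move=> [M M0 aM]; split => //.
suff : continuous a' by [].
apply/linear_bounded_continuous/linear_boundedP; near=> r => v.
apply: (@le_trans _ _ (M%:C * `|v|)).
  by rewrite !normE -rmorphM lecR; exact: aM.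
rewrite ler_wpM2r//; near: r; apply: nbhs_pinfty_ge.
by rewrite ger0_real// ler0c.
Unshelve. all: by end_near. Qed.

Lemma opnorm_ge0 a : 0 <= opnorm a.
Proof.
(* If no bound exists, the set is empty and its infimum is 0 by convention. *)
rewrite /opnorm; have [->|/set0P ne] := eqVneq [set M : R | 0 <= M /\ forall v, `|a v| <= M%:C * `|v|] set0.
  by rewrite inf0.
by apply: lb_le_inf => // M [].
Qed.

Lemma opnorm_le a M : 0 <= M -> (forall v, nrm (a v) <= M * nrm v) -> opnorm a <= M.
Proof.
move=> M0 aM; apply: ge_inf; first by exists 0 => N [].
by split=> // v; rewrite !normE -rmorphM lecR.
Qed.

Lemma nrm_opnorm a v : bounded_operators a -> nrm (a v) <= opnorm a * nrm v.
Proof.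
move=> /bounded_operatorsP[la [M M0 aM]].
have [->|/eqP/nrm_gt0 v0] := eqVneq v 0; first by rewrite (op0 la)// nrm0 mulr0.
rewrite -ler_pdivrMr//; apply: lb_le_inf.
  by exists M; split => // w; rewrite !normE -rmorphM lecR.
move=> N [N0 aN]; rewrite ler_pdivrMr//.
by have := aN v; rewrite !normE -rmorphM lecR.
Qed.

Lemma bounded_operators_id : bounded_operators (@id E).
Proof. by apply/bounded_operatorsP; split=> //; exists 1 => // v; rewrite mul1r. Qed.

Lemma bounded_operators_linear (c : R[i]) a b :
  bounded_operators a -> bounded_operators b -> bounded_operators (c *: a + b).
Proof.
move=> /bounded_operatorsP[la [M M0 aM]] /bounded_operatorsP[lb [N N0 bN]].
apply/bounded_operatorsP; split=> [k u v|].
  have cab w : (c *: a + b) w = c *: a w + b w by [].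
  by rewrite !cab la lb !scalerDr !scalerA [k * c]mulrC addrACA.
exists (nrm (c : R[i]^o) * M + N) => [|v]; first by rewrite addr_ge0// mulr_ge0// nrm_ge0.
apply: le_trans (nrmD _ _) _; rewrite nrmZ mulrDl lerD// -mulrA.
by rewrite ler_wpM2l// nrm_ge0.
Qed.

Lemma bounded_operators_comp a b :
  bounded_operators a -> bounded_operators b -> bounded_operators (a \o b).
Proof.
move=> /bounded_operatorsP[la [M M0 aM]] /bounded_operatorsP[lb [N N0 bN]].
apply/bounded_operatorsP; split=> [k u v|]; first by rewrite /= lb la.
exists (M * N) => [|v /=]; first by rewrite mulr_ge0.
by apply: le_trans (aM _) _; rewrite -mulrA ler_wpM2l.
Qed.

End BoundedOperators.

(** * Coordinate projections and matrix entries of operators *)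

Section BasisOperators.
Variables (R : realType) (E : completeNormedModType R[i]) (e : nat -> E).
Hypothesis basis : schauder_basis e.
Implicit Types (a b : E -> E).

Definition proj (n : nat) (v : E) : E := coord e n v *: e n.

Lemma proj_bounded : exists2 P : R, 0 <= P & forall n v, nrm (proj n v) <= P * nrm v.
Proof.
have [M M0 eM] := basis_constant basis; exists (2 * M) => [|n v]; first lra.
by have := coord_nrm e n v; have := eM n.+1 v; have := eM n v; rewrite /proj; lra.
Qed.

Lemma proj_basis n m : proj n (e m) = (n == m)%:R *: e n.
Proof. by rewrite /proj coord_basis. Qed.

Lemma proj_bounded_operator n : bounded_operators (proj n).
Proof.
apply/bounded_operatorsP; split=> [c u v|].
  by rewrite /proj coordD// coordZ// scalerDl scalerA.
by have [P P0 eP] := proj_bounded; exists P.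
Qed.

Lemma coord_eq0 v : (forall n, coord e n v = 0) -> v = 0.
Proof.
move=> v0; apply: (cvg_uniq (@coordP _ _ _ basis v)).
rewrite (_ : psum e ^~ v = cst 0); first exact: cvg_cst.
by apply/funext => m; rewrite /psum big1// => k _; rewrite v0 scale0r.
Qed.

(** By continuity, [coord e m (a v)] is the limit of the finite sums of the products
    [coord e k v * coord e m (a (e k))], all of which vanish here. *)
Lemma coord_op_eq0 a v m : bounded_operators a ->
  (forall k, coord e k v = 0 \/ coord e m (a (e k)) = 0) -> coord e m (a v) = 0.
Proof.
move=> /bounded_operatorsP[la [A A0 aA]] v0.
have [P P0 eP] := proj_bounded.
have s0 n : coord e m (a (psum e n v)) = 0.
  elim: n => [|n IH]; first by rewrite /psum big_nil (op0 la)// coord0.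
  rewrite psumS// (opD la)// coordD// IH add0r (opZ la)// coordZ//.
  by case: (v0 n) => ->; rewrite ?mul0r ?mulr0.
suff p0 : nrm (proj m (a v)) <= 0.
  have /nrm_eq0/eqP : nrm (proj m (a v)) = 0 by apply/le_anti; rewrite p0 nrm_ge0.
  by rewrite scaler_eq0 => /orP[/eqP//|/eqP/(@basis_neq0 _ _ _ basis m)].
apply/ler_addgt0Pr => eps eps0; rewrite add0r.
have PA : 0 <= P * A by rewrite mulr_ge0.
have /cvg_nrmP/(_ (eps / (P * A + 1)))[|N /(_ N (leqnn N)) NP] := @coordP _ _ _ basis v.
  by rewrite divr_gt0//; lra.
have -> : proj m (a v) = proj m (a (v - psum e N v)).
  by rewrite (opB la)// /proj coordB// s0 subr0.
apply: le_trans (eP _ _) _; apply: le_trans (ler_wpM2l P0 (aA _)) _.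
rewrite mulrA; move: NP; rewrite ltr_pdivlMr; last lra.
by have := nrm_ge0 (v - psum e N v); lra.
Qed.

Lemma op_ext a b : bounded_operators a -> bounded_operators b ->
  (forall n, a (e n) = b (e n)) -> a = b.
Proof.
move=> ba bb ab; apply/funext => v; apply/subr0_eq/coord_eq0 => m.
have bab : bounded_operators (-1 *: b + a) by exact: bounded_operators_linear.
have abE w : (-1 *: b + a) w = a w - b w.
  by rewrite -[LHS]/(-1 *: b w + a w) scaleN1r addrC.
rewrite -abE; apply: coord_op_eq0 => // k; right.
by rewrite abE ab subrr coord0.
Qed.

End BasisOperators.

(** * Closure properties of the uniform Roe algebra *)

Section RoeAlgebra.
Variables (R : realType) (E : completeNormedModType R[i]) (e : nat -> E).
Hypothesis basis : schauder_basis e.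
Variable d : nat -> nat -> R.
Hypothesis d_metric : is_metric d.
Implicit Types (a b : E -> E).

Lemma roeP a : uniform_roe_algebra d e a <->
  bounded_operators a /\ forall eps : R, 0 < eps ->
    exists2 b, band_operators d e b & forall v, nrm (a v - b v) <= eps * nrm v.
Proof.
split=> -[ba aeps]; split=> // eps eps0.
  have [b db ab] := aeps _ eps0; exists b => // v.
  have bab : bounded_operators (a - b).
    have -> : a - b = -1 *: b + a by rewrite scaleN1r addrC.
    by apply: bounded_operators_linear => //; case: db.
  apply: le_trans (nrm_opnorm v bab) _.
  by rewrite ler_wpM2r ?nrm_ge0// ltW.
(* A pointwise bound gives only a weak inequality for [opnorm]; halving makes it strict. *)
have [|b db ab] := aeps (eps / 2); first lra.
exists b => //; apply: (@le_lt_trans _ _ (eps / 2)); last lra.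
by apply: opnorm_le => //; lra.
Qed.

Lemma band_roe a : band_operators d e a -> uniform_roe_algebra d e a.
Proof.
move=> da; apply/roeP; split; first by case: da.
move=> eps eps0; exists a => // v; rewrite subrr nrm0.
by rewrite mulr_ge0 ?nrm_ge0// ltW.
Qed.

Lemma band_linear (c : R[i]) a b :
  band_operators d e a -> band_operators d e b -> band_operators d e (c *: a + b).
Proof.
move=> [ba [r r0 ar]] [bb [s s0 bs]]; split; first exact: bounded_operators_linear.
exists (r + s) => [|n m nm]; first exact: addr_gt0.
rewrite [X in coord e m X](_ : _ = c *: a (e n) + b (e n))//.
by rewrite coordD// coordZ// ar ?bs ?mulr0 ?addr0//; lra.
Qed.

(** Propagations add: if [n] and [m] are further apart than [r + s], each intermediate index [k] is
    further than [s] from [n] or further than [r] from [m]. *)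
Lemma band_comp a b :
  band_operators d e a -> band_operators d e b -> band_operators d e (a \o b).
Proof.
move=> [ba [r r0 ar]] [bb [s s0 bs]]; split; first exact: bounded_operators_comp.
exists (r + s) => [|n m nm]; first exact: addr_gt0.
apply: (@coord_op_eq0 _ _ _ basis a (b (e n))) => // k.
have [nk|nk] := ltP s (d n k); first by left; apply: bs.
right; apply: ar; have [_ _ _ tri] := d_metric.
by have := tri n k m; lra.
Qed.

Lemma roe_linear (c : R[i]) a b : uniform_roe_algebra d e a ->
  uniform_roe_algebra d e b -> uniform_roe_algebra d e (c *: a + b).
Proof.
move=> /roeP[ba aR] /roeP[bb bR]; apply/roeP; split.
  exact: bounded_operators_linear.
move=> eps eps0; have c0 := nrm_ge0 (c : R[i]^o).
have [|a' da' aa'] := aR (eps / 2 / (nrm (c : R[i]^o) + 1)).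
  by rewrite !divr_gt0//; lra.
have [|b' db' bb'] := bR (eps / 2); first lra.
exists (c *: a' + b') => [|v]; first exact: band_linear.
have -> : (c *: a + b) v - (c *: a' + b') v = c *: (a v - a' v) + (b v - b' v).
  by rewrite scalerBr addrACA -opprD.
apply: le_trans (nrmD _ _) _; rewrite nrmZ.
have := bb' v; have := ler_wpM2l c0 (aa' v).
suff : nrm (c : R[i]^o) * (eps / 2 / (nrm (c : R[i]^o) + 1) * nrm v) <= eps / 2 * nrm v.
  by lra.
rewrite mulrA ler_wpM2r ?nrm_ge0// mulrA ler_pdivrMr; last lra.
nra.
Qed.

Lemma roe_comp a b : uniform_roe_algebra d e a ->
  uniform_roe_algebra d e b -> uniform_roe_algebra d e (a \o b).
Proof.
move=> /roeP[ba aR] /roeP[bb bR]; apply/roeP; split.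
  exact: bounded_operators_comp.
move=> eps eps0; have /bounded_operatorsP[la [A A0 aA]] := ba.
(* The approximant [b'] comes first, since the accuracy required of [a'] depends on the bound [B] of
   [b']. *)
have [|b' db' bb'] := bR (eps / 2 / (A + 1)); first by rewrite !divr_gt0//; lra.
have /bounded_operatorsP[_ [B B0 bB]] : bounded_operators b' by case: db'.
have [|a' da' aa'] := aR (eps / 2 / (B + 1)); first by rewrite !divr_gt0//; lra.
exists (a' \o b') => [|v /=]; first exact: band_comp.
have -> : a (b v) - a' (b' v) = a (b v - b' v) + (a (b' v) - a' (b' v)).
  by rewrite (opB la)// addrA subrK.
apply: le_trans (nrmD _ _) _.
have := aA (b v - b' v); have := ler_wpM2l A0 (bb' v); have := aa' (b' v).
have small (B' : R) : 0 <= B' -> eps / 2 / (B' + 1) * B' <= eps / 2.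
  by move=> B'0; rewrite mulrAC ler_pdivrMr; [nra|lra].
have q0 : 0 <= eps / 2 / (B + 1) by rewrite !divr_ge0//; lra.
have := ler_wpM2l q0 (bB v).
have := ler_wpM2r (nrm_ge0 v) (small _ A0).
have := ler_wpM2r (nrm_ge0 v) (small _ B0).
by lra.
Qed.

Lemma metric_xx n : d n n = 0.
Proof. by have [_ d0 _ _] := d_metric; apply/d0. Qed.

Lemma band_diag a : bounded_operators a ->
  (forall n m, m != n -> coord e m (a (e n)) = 0) -> band_operators d e a.
Proof.
move=> ba a0; split=> //; exists 1 => // n m nm; apply: a0.
by apply/eqP => mn; move: nm; rewrite mn metric_xx ltr10.
Qed.

Lemma roe_id : uniform_roe_algebra d e id.
Proof.
apply/band_roe/band_diag; first exact: bounded_operators_id.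
by move=> n m /negPf mn; rewrite coord_basis// mn.
Qed.

Lemma roe_proj n : uniform_roe_algebra d e (proj e n).
Proof.
apply/band_roe/band_diag; first exact: proj_bounded_operator.
move=> k m mk; rewrite proj_basis// coordZ// coord_basis//.
have [->|] := eqVneq n k; first by rewrite (negPf mk) mulr0.
by rewrite mul0r.
Qed.

End RoeAlgebra.

(** * The bijection of indices induced by an isomorphism *)

Section PositiveOperators.
Variables (R : realType) (E : completeNormedModType R[i]) (e : nat -> E).
Hypothesis basis : schauder_basis e.

Lemma positive_coneP v : positive_cone e v <-> forall n, 0 <= coord e n v.
Proof.
split=> [[c c0 cv] n|v0]; first by rewrite (coord_unique basis n cv).
by exists (coord e ^~ v) => //; exact: (@coordP _ _ _ basis v).
Qed.

Lemma positive_cone_basis n : positive_cone e (e n).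
Proof. by apply/positive_coneP => m; rewrite coord_basis// ler0n. Qed.

Lemma coord_proj n m v : coord e m (proj e n v) = (m == n)%:R * coord e n v.
Proof. by rewrite /proj coordZ// coord_basis// mulrC. Qed.

Lemma positive_proj n : positive_operator e (proj e n).
Proof.
move=> v /positive_coneP v0; apply/positive_coneP => m.
by rewrite coord_proj mulr_ge0.
Qed.

(** The complement of the projection is written in the form that [algebra_hom_on] transports. *)
Lemma positive_id_sub_proj n : positive_operator e (-1 *: proj e n + id).
Proof.
move=> v /positive_coneP v0; apply/positive_coneP => m.
rewrite [X in coord e m X](_ : _ = -1 *: proj e n v + v)//.
rewrite coordD// coordZ// coord_proj; have [->|_] := eqVneq m n.
  by rewrite mul1r mulN1r addNr.
by rewrite mul0r mulr0 add0r.
Qed.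

End PositiveOperators.

(* A symmetric form of the hypotheses of the theorem, in which [Psi] is the
   inverse of [Phi]. *)
Record ordered_roe_iso (R : realType) (E F : completeNormedModType R[i])
    (e : nat -> E) (f : nat -> F) (d dd : nat -> nat -> R)
    (Phi : (E -> E) -> F -> F) (Psi : (F -> F) -> E -> E) : Prop := {
  iso_roe : forall a, uniform_roe_algebra d e a -> uniform_roe_algebra dd f (Phi a);
  iso_roeV : forall b, uniform_roe_algebra dd f b -> uniform_roe_algebra d e (Psi b);
  isoK : forall a, uniform_roe_algebra d e a -> Psi (Phi a) = a;
  isoVK : forall b, uniform_roe_algebra dd f b -> Phi (Psi b) = b;
  iso_hom : algebra_hom_on (uniform_roe_algebra d e) Phi;
  iso_homV : algebra_hom_on (uniform_roe_algebra dd f) Psi;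
  iso_bounded : bounded_on (uniform_roe_algebra d e) Phi;
  iso_boundedV : bounded_on (uniform_roe_algebra dd f) Psi;
  iso_pos : positive_on e f (uniform_roe_algebra d e) Phi;
  iso_posV : positive_on f e (uniform_roe_algebra dd f) Psi }.

Lemma ordered_roe_iso_sym (R : realType) (E F : completeNormedModType R[i])
    (e : nat -> E) (f : nat -> F) (d dd : nat -> nat -> R)
    (Phi : (E -> E) -> F -> F) (Psi : (F -> F) -> E -> E) :
  ordered_roe_iso e f d dd Phi Psi -> ordered_roe_iso f e dd d Psi Phi.
Proof. by case=> *; split. Qed.

(** The algebraic identities for the inverse are checked after applying [Phi], which is injective on
    the algebra; closure of both algebras under the operations makes this legitimate. *)
Lemma ordered_roe_iso_pinv (R : realType) (E F : completeNormedModType R[i])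
    (e : nat -> E) (f : nat -> F) (d dd : nat -> nat -> R) (Phi : (E -> E) -> F -> F) :
  is_metric d -> is_metric dd -> schauder_basis e -> schauder_basis f ->
  banach_algebra_iso (uniform_roe_algebra d e) (uniform_roe_algebra dd f) Phi ->
  order_iso e f (uniform_roe_algebra d e) (uniform_roe_algebra dd f) Phi ->
  ordered_roe_iso e f d dd Phi ('pinv_(fun=> 0) (uniform_roe_algebra d e) Phi).
Proof.
move=> d_metric dd_metric e_basis f_basis [bij [lin mul] bnd bndV] [_ pos posV].
set Psi := 'pinv_ _ _ _.
have [fun_ inj surj] := bij.
have VK b : uniform_roe_algebra dd f b -> Phi (Psi b) = b.
  by move=> Bb; apply: (surjpK _ surj); rewrite inE.
have BV b : uniform_roe_algebra dd f b -> uniform_roe_algebra d e (Psi b).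
  by move=> Bb; apply: (surjpinv_image_sub surj); exists b.
have injE a a' : uniform_roe_algebra d e a -> uniform_roe_algebra d e a' ->
    Phi a = Phi a' -> a = a'.
  by move=> Aa Aa' /inj; apply; rewrite inE.
split=> //.
- by move=> a Aa; apply: injE => //; rewrite ?VK//; [apply: BV|]; apply: fun_.
- split=> [c a b Ba Bb|a b Ba Bb].
    have Ac := roe_linear e_basis c (BV _ Ba) (BV _ Bb).
    have Bc := roe_linear f_basis c Ba Bb.
    by apply: injE (BV _ Bc) Ac _; rewrite lin ?VK//; exact: BV.
  have Ac := roe_comp e_basis d_metric (BV _ Ba) (BV _ Bb).
  have Bc := roe_comp f_basis dd_metric Ba Bb.
  by apply: injE (BV _ Bc) Ac _; rewrite mul ?VK//; exact: BV.
Qed.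

Section DiagonalProjections.
Variables (R : realType) (E F : completeNormedModType R[i]).
Variables (e : nat -> E) (f : nat -> F) (d dd : nat -> nat -> R).
Hypotheses (e_basis : schauder_basis e) (f_basis : schauder_basis f).
Hypotheses (d_metric : is_metric d) (dd_metric : is_metric dd).
Variables (Phi : (E -> E) -> F -> F) (Psi : (F -> F) -> E -> E).
Hypothesis iso : ordered_roe_iso e f d dd Phi Psi.

(** The identity of the target is [Phi (Psi id)]; multiplicativity applied to [id \o Psi id]
    identifies it with [Phi id]. *)
Lemma iso_id : Phi id = id.
Proof.
have [_ mul] := iso_hom iso.
have Bid := roe_id f_basis dd_metric; have Aid := roe_id e_basis d_metric.
by have := mul id (Psi id) Aid (iso_roeV iso Bid); rewrite (isoVK iso)//.
Qed.

Lemma iso0 : Phi 0 = 0.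
Proof.
have [lin _] := iso_hom iso.
have Aid := roe_id e_basis d_metric.
have := lin (-1) id id Aid Aid; rewrite iso_id.
by rewrite !scaleN1r !addNr.
Qed.

Lemma roe0 : uniform_roe_algebra d e 0.
Proof.
have Aid := roe_id e_basis d_metric.
have := roe_linear e_basis (-1) Aid Aid.
by rewrite scaleN1r addNr.
Qed.

Lemma isoZ (c : R[i]) a : uniform_roe_algebra d e a -> Phi (c *: a) = c *: Phi a.
Proof.
move=> Aa; have [lin _] := iso_hom iso.
by have := lin c a 0 Aa roe0; rewrite iso0 !addr0.
Qed.

(* [0 <= proj e n <= 1] is transported by [Phi], and an operator between [0]
   and [1] is diagonal. *)
Lemma iso_proj_diag n k : Phi (proj e n) (f k) = coord f k (Phi (proj e n) (f k)) *: f k.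
Proof.
have [lin _] := iso_hom iso; have Ap := roe_proj e_basis d_metric n.
have Aid := roe_id e_basis d_metric.
apply/subr0_eq/(coord_eq0 f_basis) => m; rewrite coordB// coordZ// coord_basis//.
have [->|mk] := eqVneq m k; first by rewrite mulr1 subrr.
(* Off the diagonal the identity has entry 0, so positivity of [Phi (proj e n)] and of its
   complement give opposite inequalities. *)
rewrite mulr0 subr0; apply/le_anti/andP; split; last first.
  suff /(positive_coneP f_basis)/(_ m) : positive_cone f (Phi (proj e n) (f k)) by [].
  apply: (iso_pos iso) => //; first exact: positive_proj.
  exact: positive_cone_basis.
have : positive_cone f (Phi (-1 *: proj e n + id) (f k)).
  apply: (iso_pos iso); [exact: roe_linear|exact: positive_id_sub_proj|].
  exact: positive_cone_basis.
rewrite lin// iso_id => /(positive_coneP f_basis)/(_ m).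
rewrite [X in coord f m X](_ : _ = -1 *: Phi (proj e n) (f k) + f k)//.
by rewrite coordD// coordZ// coord_basis// (negPf mk) addr0 mulN1r oppr_ge0.
Qed.

Lemma iso_proj_neq0 n : exists k, Phi (proj e n) (f k) <> 0.
Proof.
apply: contrapT => no; have Ap := roe_proj e_basis d_metric n.
have Phi0 : Phi (proj e n) = 0.
  apply: (op_ext f_basis).
  - by case: (iso_roe iso Ap).
  - by rewrite -iso0; case: (iso_roe iso roe0).
  - by move=> k; apply: contrapT => k0; apply: no; exists k.
have := isoK iso Ap; rewrite Phi0 -iso0 (isoK iso roe0) => p0.
apply: (@basis_neq0 _ _ _ e_basis n).
by have := proj_basis e_basis n n; rewrite -p0 eqxx scale1r => <-.
Qed.

End DiagonalProjections.

Section IndexBijection.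
Variables (R : realType) (E F : completeNormedModType R[i]).
Variables (e : nat -> E) (f : nat -> F) (d dd : nat -> nat -> R).
Hypotheses (e_basis : schauder_basis e) (f_basis : schauder_basis f).
Hypotheses (d_metric : is_metric d) (dd_metric : is_metric dd).

(** Pick [m] where the diagonal operator [Q] has a nonzero entry [q]. Pulling
    [Q \o proj f m = q *: proj f m] back by [Psi] shows that [T], also diagonal, lives only at [n],
    so [T = t *: proj e n] and [proj f m = t *: Q]. Comparing entries forces [q = t = 1]. *)
Lemma iso_proj (Phi : (E -> E) -> F -> F) (Psi : (F -> F) -> E -> E) n :
  ordered_roe_iso e f d dd Phi Psi -> exists m, Phi (proj e n) = proj f m.
Proof.
move=> iso; have isoV := ordered_roe_iso_sym iso.
have [lin mul] := iso_hom iso.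
set Q := Phi (proj e n); have Ap := roe_proj e_basis d_metric n.
have [m Qm0] := iso_proj_neq0 e_basis f_basis d_metric dd_metric iso n.
pose q := coord f m (Q (f m)).
have Qm : Q (f m) = q *: f m by exact: (iso_proj_diag e_basis f_basis d_metric dd_metric iso).
pose T := Psi (proj f m); have Bp := roe_proj f_basis dd_metric m.
have AT : uniform_roe_algebra d e T by exact: (iso_roeV iso).
have Tdiag k : T (e k) = coord e k (T (e k)) *: e k.
  exact: (iso_proj_diag f_basis e_basis dd_metric d_metric isoV).
have QpE : Q \o proj f m = q *: proj f m.
  apply: (op_ext f_basis).
  - apply: bounded_operators_comp; last exact: proj_bounded_operator.
    by case: (iso_roe iso Ap).
  (* The multiple [q *: proj f m] is viewed as [(q - 1) *: proj f m + proj f m], to fit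
     [bounded_operators_linear]. *)
  - have bp := proj_bounded_operator f_basis m.
    have := bounded_operators_linear (q - 1) bp bp.
    by rewrite scalerBl scale1r subrK.
  - move=> k; rewrite /= -[RHS]/(q *: proj f m (f k)) proj_basis//.
    have [_|_] := eqVneq m k; first by rewrite scale1r Qm.
    have [lQ _] : bounded_operators Q by case: (iso_roe iso Ap).
    by rewrite scale0r scaler0 (op0 lQ).
have AqT : uniform_roe_algebra d e (q *: T).
  rewrite -[q *: T]addr0; apply: roe_linear => //; exact: roe0.
have pTE : proj e n \o T = q *: T.
  rewrite -(isoK iso (roe_comp e_basis d_metric Ap AT)) -(isoK iso AqT).
  rewrite mul// (isoZ e_basis f_basis d_metric dd_metric iso)//.
  by rewrite (isoVK iso Bp) QpE.
have pTk k : proj e n (T (e k)) = q *: T (e k).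
  by have := congr1 (fun g => g (e k)) pTE.
have q0 : q != 0 by apply/eqP => q0; apply: Qm0; rewrite -/Q Qm q0 scale0r.
have Tk0 k : k != n -> T (e k) = 0.
  move=> kn; have := pTk k; rewrite [in LHS]Tdiag /proj coordZ// coord_basis//.
  rewrite eq_sym (negPf kn) mulr0 scale0r => /esym/eqP.
  by rewrite scaler_eq0 (negPf q0) => /eqP.
pose t := coord e n (T (e n)).
have Tn : T (e n) = t *: e n by exact: Tdiag.
have t0 : t != 0.
  apply/eqP => t0; have [k] := iso_proj_neq0 f_basis e_basis dd_metric d_metric isoV m.
  apply; have [->|/Tk0//] := eqVneq k n.
  by rewrite -/T Tn t0 scale0r.
have TE : T = t *: proj e n.
  apply: (op_ext e_basis).
  - by case: AT.
  - have bp := proj_bounded_operator e_basis n.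
    have := bounded_operators_linear (t - 1) bp bp.
    by rewrite scalerBl scale1r subrK.
  - move=> k; rewrite -[RHS]/(t *: proj e n (e k)) proj_basis// eq_sym.
    have [->|kn] := eqVneq k n; first by rewrite scale1r.
    by rewrite scale0r scaler0 Tk0.
have PE : proj f m = t *: Q.
  rewrite -(isoVK iso Bp) -/T TE (isoZ e_basis f_basis d_metric dd_metric iso)//.
have en0 : e n != 0 by apply/eqP; exact: (@basis_neq0 _ _ _ e_basis n).
(* [T (e n)] is a multiple of [e n], hence fixed by [proj e n], so [pTk] reads [t = q * t]. *)
have q1 : q = 1.
  have := pTk n; rewrite Tn /proj coordZ// coord_basis// eqxx mulr1 scalerA.
  move=> /eqP; rewrite -subr_eq0 -scalerBl scaler_eq0 (negPf en0) orbF subr_eq0.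
  by move=> /eqP tq; apply/(mulIf t0); rewrite mul1r.
have fm0 : f m != 0 by apply/eqP; exact: (@basis_neq0 _ _ _ f_basis m).
exists m; rewrite PE; suff -> : t = 1 by rewrite scale1r.
have := congr1 (fun g => g (f m)) PE; rewrite proj_basis// eqxx scale1r.
rewrite -[X in _ = X]/(t *: Q (f m)) Qm q1 scale1r => /eqP.
by rewrite -subr_eq0 -{1}[f m]scale1r -scalerBl scaler_eq0 (negPf fm0) orbF subr_eq0 => /eqP.
Qed.

Lemma proj_inj : injective (proj f).
Proof.
move=> m n mn; apply/eqP; apply: contrapT => /negP/negPf nm.
have := proj_basis f_basis m m; rewrite mn proj_basis// eqxx eq_sym nm scale1r scale0r.
by move/esym; exact: (@basis_neq0 _ _ _ f_basis m).
Qed.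

End IndexBijection.

Lemma iso_index_bijection (R : realType) (E F : completeNormedModType R[i])
    (e : nat -> E) (f : nat -> F) (d dd : nat -> nat -> R)
    (Phi : (E -> E) -> F -> F) (Psi : (F -> F) -> E -> E) :
  schauder_basis e -> schauder_basis f -> is_metric d -> is_metric dd ->
  ordered_roe_iso e f d dd Phi Psi ->
  exists s t : nat -> nat, [/\ cancel s t, cancel t s,
    forall n, Phi (proj e n) = proj f (s n) & forall n, Psi (proj f n) = proj e (t n)].
Proof.
move=> e_basis f_basis d_metric dd_metric iso.
have isoV := ordered_roe_iso_sym iso.
have [s sP] := choice (fun n => iso_proj e_basis f_basis d_metric dd_metric n iso).
have [t tP] := choice (fun n => iso_proj f_basis e_basis dd_metric d_metric n isoV).
exists s, t; split=> // n.
  apply: (proj_inj e_basis); rewrite -tP -sP.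
  by rewrite (isoK iso)//; exact: roe_proj.
apply: (proj_inj f_basis); rewrite -sP -tP.
by rewrite (isoVK iso)//; exact: roe_proj.
Qed.

(** * Coarseness of the induced bijection *)

Section FarInvolution.
Variables (R : realType) (d dd : nat -> nat -> R) (s : nat -> nat).
Hypotheses (d_metric : is_metric d) (dd_metric : is_metric dd).
Hypothesis d_ulf : uniformly_locally_finite d.

Lemma finite_set_bounded (T : eqType) (A : set T) (g : T -> R) :
  finite_set A -> exists B, forall x, A x -> g x <= B.
Proof.
move=> /finite_seqP[u ->]; elim: u => [|x u [B IH]]; first by exists 0.
exists (Num.max (g x) B) => y /=; rewrite inE => /orP[/eqP->|/IH yB].
  by rewrite le_max lexx.
by rewrite le_max yB orbT.
Qed.

(** By local finiteness, only finitely many pairs of [r]-close points meet the indices below [N]. *)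
Lemma image_near_bounded (r : R) (N : nat) : 0 < r ->
  exists B, forall x y, d x y < r -> (x < N)%N || (y < N)%N -> dd (s x) (s y) <= B.
Proof.
have [_ _ dC _] := d_metric; have [_ _ ddC _] := dd_metric.
move=> r0; suff [B BP] : exists B, forall x y, d x y < r -> (x < N)%N -> dd (s x) (s y) <= B.
  exists B => x y xy /orP[|yN]; first exact: BP.
  by rewrite ddC; apply: BP; rewrite // dC.
elim: N => [|N [B IH]]; first by exists 0.
have [K KP] := d_ulf r0.
have /finite_set_bounded : finite_set [set y | d N y <= r] by apply/finite_set_leP; exists K.
move=> /(_ (fun y => dd (s N) (s y)))[B' B'P].
exists (Num.max B B') => x y xy; rewrite ltnS leq_eqVlt le_max => /orP[/eqP xN|xN].
  by rewrite xN B'P ?orbT//= -xN ltW.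
by rewrite IH.
Qed.

(* If [s] is not coarse, pairs of uniformly close points with images further
   and further apart can be chosen beyond any index, hence pairwise disjoint;
   the involution swaps them. *)
Lemma far_involution : ~ coarse d dd s ->
  exists r, exists2 p : nat -> nat, involutive p &
    (forall n, d n (p n) < r) /\ forall N : nat, exists x, N%:R <= dd (s x) (s (p x)).
Proof.
have [_ d0 dC _] := d_metric; have [_ _ ddC _] := dd_metric.
move=> ncoarse; have [r r0 rP] : exists2 r, 0 < r & forall t : R, 0 < t ->
    exists x y, d x y < r /\ t <= dd (s x) (s y).
  apply: contrapT => no; apply: ncoarse => r r0; apply: contrapT => no'.
  apply: no; exists r => // t t0; apply: contrapT => no''.
  apply: no'; exists t => // x y xy; rewrite ltNge; apply/negP => tle.
  by apply: no''; exists x, y.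
have /choice[h hP] N : exists q : nat * nat,
    [/\ (N <= q.1)%N, (N <= q.2)%N, d q.1 q.2 < r & N%:R <= dd (s q.1) (s q.2)].
  have [B BP] := image_near_bounded N r0.
  have N0 : 0 <= N%:R :> R by [].
  have B0 : 0 <= `|B| by [].
  (* A threshold above [B] rules out pairs meeting the indices below [N]; the absolute value and the
     1 keep it positive. *)
  have [|x [y [xy xyB]]] := rP (`|B| + N%:R + 1); first by lra.
  have : ~~ ((x < N)%N || (y < N)%N).
    by apply/negP => /(BP _ _ xy) dB; have := ler_norm B; lra.
  rewrite negb_or -!leqNgt => /andP[Nx Ny].
  by exists (x, y); split => //=; lra.
(* The [k]-th pair lies in the interval from [t k] (included) to [t k.+1] (excluded), so distinct
   pairs are disjoint. *)
pose t := fix t k := if k is l.+1 then (maxn (h (t l)).1 (h (t l)).2).+1 else 0%N.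
have tS k u : u = (h (t k)).1 \/ u = (h (t k)).2 -> (t k <= u < t k.+1)%N.
  have [h1 h2 _ _] := hP (t k).
  by case=> ->; rewrite ?h1 ?h2 /= ltnS leq_max leqnn ?orbT.
have tinc k : (t k < t k.+1)%N.
  by have /andP[l1 l2] := tS k _ (or_introl erefl); exact: leq_ltn_trans l2.
have tle k l : (k <= l)%N -> (t k <= t l)%N.
  by move=> /subnK <-; elim: (l - k)%N => [//|j]; move/leq_trans; apply; exact: ltnW.
have tk k : (k <= t k)%N by elim: k => // k; move/leq_ltn_trans; apply.
have same k l u : u = (h (t k)).1 \/ u = (h (t k)).2 ->
    u = (h (t l)).1 \/ u = (h (t l)).2 -> k = l.
  move=> /tS/andP[k1 k2] /tS/andP[l1 l2].
  have [kl|lk|//] := ltngtP k l.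
    by have := leq_trans k2 (leq_trans (tle _ _ kl) l1); rewrite ltnn.
  by have := leq_trans l2 (leq_trans (tle _ _ lk) k1); rewrite ltnn.
pose M u : set nat := [set v | exists k,
  (u = (h (t k)).1 /\ v = (h (t k)).2) \/ (u = (h (t k)).2 /\ v = (h (t k)).1)].
have MC u v : M u v -> M v u by move=> [k [[-> ->]|[-> ->]]]; exists k; [right|left].
have Mfun u v w : M u v -> M u w -> v = w.
  move=> [k kP] [l lP].
  have kl : k = l.
    apply: (same k l u).
      by case: kP => -[-> _]; [left|right].
    by case: lP => -[-> _]; [left|right].
  rewrite -{}kl in lP.
  by case: kP => -[u1 v1]; case: lP => -[u2 v2]; congruence.
(* The default value [u] makes [p] fix every index outside the pairs. *)
pose p u := xget u (M u).
have pM u v : M u v -> p u = v by move=> Muv; apply: xget_unique => // w Muw; exact: (Mfun u).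
exists r, p.
  move=> u; have [[v Muv]|no] := pselect (exists v, M u v).
    by rewrite (pM _ _ Muv); apply/pM/MC.
  have pu : p u = u by apply: xgetPN => v Muv; apply: no; exists v.
  by rewrite !pu.
split=> [u|N].
  have [[v Muv]|no] := pselect (exists v, M u v).
    rewrite (pM _ _ Muv); case: Muv => k; have [_ _ hr _] := hP (t k).
    by case=> -[-> ->]; rewrite // dC.
  have -> : p u = u by apply: xgetPN => v Muv; apply: no; exists v.
  by have /d0 -> : u = u by [].
(* The images of this pair are at distance at least [t N], and [N <= t N]. *)
exists (h (t N)).1; rewrite (pM _ (h (t N)).2); last by exists N; left.
have [_ _ _] := hP (t N); apply: le_trans.
by rewrite ler_nat.
Qed.

End FarInvolution.

(** * Operators permuting a symmetric basis *)

Section PermutationOperator.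
Variables (R : realType) (E : completeNormedModType R[i]) (e : nat -> E).
Hypothesis basis : schauder_basis e.

(** Equivalence of sequences compares only initial sums; zeroing the first [j] coefficients brings
    tails into that form. *)
Lemma sum_tail (u : nat -> E) (c : nat -> R[i]) j q : (j <= q)%N ->
  \sum_(0 <= k < q) (if (k < j)%N then 0 else c k) *: u k =
  \sum_(0 <= k < q) c k *: u k - \sum_(0 <= k < j) c k *: u k.
Proof.
move=> jq; rewrite (big_cat_nat (leq0n j) jq)//= [in RHS](big_cat_nat (leq0n j) jq)//= addrAC subrr.
congr (_ + _).
  by apply: big1_seq => k; rewrite mem_index_iota => /andP[_ /andP[_ ->]]; rewrite scale0r.
apply: eq_big_nat => k /andP[jk _].
by rewrite ltnNge jk.
Qed.

(** Equivalence makes the permuted expansion of each vector Cauchy; its limit defines the operator,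
    bounded by [lambda] times the basis constant. The second conclusion, from one-term sums, later
    bounds blocks of the operator from below. *)
Lemma permutation_operator (p : nat -> nat) : equivalent_seq e (e \o p) ->
  (exists2 a, bounded_operators a & forall n, a (e n) = e (p n)) /\
  exists2 lambda : R, 0 < lambda & forall n, nrm (e (p n)) <= lambda * nrm (e n).
Proof.
move=> [lambda lambda1 equiv]; have l0 : 0 < lambda by lra.
have le (c : nat -> R[i]) q : nrm (\sum_(0 <= k < q) c k *: e (p k)) <=
    lambda * nrm (\sum_(0 <= k < q) c k *: e k).
  (* Equivalence concerns sums of at least one term, so the empty sum is separate. *)
  case: q => [|q]; first by rewrite !big_nil nrm0 mulr0.
  have /andP[_] := equiv q c; rewrite !normE -rmorphM lecR.
  by rewrite !big_mkord.
split; last first.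
  exists lambda => // n; have := le (fun k => (k == n)%:R) n.+1.
  by rewrite !sum_delta.
pose T v q := \sum_(0 <= k < q) coord e k v *: e (p k).
have Tle v j q : (j <= q)%N -> nrm (T v q - T v j) <= lambda * nrm (psum e q v - psum e j v).
  move=> jq; rewrite /T -(sum_tail (e \o p) (coord e ^~ v) jq).
  by rewrite /psum -(sum_tail e (coord e ^~ v) jq); exact: le.
have /choice[a aP] v : exists w : E, T v @ \oo --> w.
  apply: nrm_cauchy => eps eps0.
  have /cvg_nrmP/(_ (eps / 4 / lambda))[|N NP] := @coordP _ _ _ basis v.
    by rewrite divr_gt0//; lra.
  exists N => i j Ni Nj.
  have tail q : (N <= q)%N -> nrm (T v q - T v N) < eps / 2.
    move=> Nq; apply: le_lt_trans (Tle _ _ _ Nq) _.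
    rewrite mulrC -ltr_pdivlMr//.
    have := nrm_triangle v (psum e q v) (psum e N v); rewrite (nrm_distC _ v).
    have := NP q Nq; have := NP N (leqnn N).
    rewrite (_ : eps / 2 / lambda = 2 * (eps / 4 / lambda)); last by field; rewrite gt_eqF.
    by lra.
  have := nrm_triangle (T v N) (T v i) (T v j); rewrite (nrm_distC (T v N)).
  by have := tail i Ni; have := tail j Nj; lra.
have a_uniq v w : T v @ \oo --> w -> a v = w by apply: cvg_uniq; exact: aP.
exists a => [|n]; last first.
  apply: a_uniq; apply/cvg_nrmP => eps eps0; exists n.+1 => q nq.
  rewrite /T (_ : \sum_(0 <= k < q) _ = e (p n)) ?subrr ?nrm0//.
  rewrite -[RHS](sum_delta (e \o p) nq); apply: eq_bigr => k _.
  by rewrite coord_basis.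
have [M M0 eM] := basis_constant basis.
apply/bounded_operatorsP; split=> [c u v|].
  apply: a_uniq; rewrite (_ : T _ = (fun q => c *: T u q + T v q)).
    by apply: cvgD; [apply: cvgZl_tmp|]; exact: aP.
  apply/funext => q; rewrite /T scaler_sumr -big_split/=.
  by apply: eq_bigr => k _; rewrite coordD// coordZ// scalerDl scalerA.
exists (lambda * M) => [|v]; first by rewrite mulr_ge0// ltW.
rewrite -nrmN -sub0r; apply: nrm_le_cvg (aP v) _ => q.
rewrite sub0r nrmN -mulrA.
have := Tle v 0%N q (leq0n q); rewrite {2}/T {2}/psum !big_nil !subr0 => /le_trans; apply.
by rewrite ler_wpM2l// ltW.
Qed.

End PermutationOperator.

(* If [s] is not coarse, let the permutation operator [a] swap the far pairs.
   Its blocks [proj e (p x) \o a \o proj e x] have norm bounded below,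
   whereas their images under [Phi] are blocks of [Phi a] arbitrarily far
   from the diagonal. *)
Lemma iso_index_coarse (R : realType) (E F : completeNormedModType R[i])
    (e : nat -> E) (f : nat -> F) (d dd : nat -> nat -> R)
    (Phi : (E -> E) -> F -> F) (Psi : (F -> F) -> E -> E) (s : nat -> nat) :
  symmetric_basis e -> schauder_basis f -> is_metric d -> is_metric dd ->
  uniformly_locally_finite d ->
  ordered_roe_iso e f d dd Phi Psi ->
  (forall n, Phi (proj e n) = proj f (s n)) -> coarse d dd s.
Proof.
move=> [e_basis e_sym] f_basis d_metric dd_metric d_ulf iso sP.
apply: contrapT => /(far_involution d_metric dd_metric d_ulf)[r [p pK [pr far]]].
have r0 : 0 < r by have [dge _ _ _] := d_metric; exact: le_lt_trans (pr 0%N).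
have [[a ba ae] [lambda l0 el]] :=
  permutation_operator e_basis (e_sym p (inv_bij pK)).
have Aa : uniform_roe_algebra d e a.
  apply: band_roe => //; split => //; exists r => // n m nm.
  rewrite ae coord_basis//; case: eqVneq => // mp.
  by move: nm; rewrite mp ltNge ltW.
have [P P0 fP] := proj_bounded f_basis.
have [C CP] := iso_boundedV iso.
(* [K] gathers the constants lost between [X] and [Y]: approximating [Phi a] within [(K + 1)^-1]
   will give the contradiction [1 <= K / (K + 1)]. *)
pose K := lambda * `|C| * (P * P).
have K0 : 0 <= K by rewrite !mulr_ge0// ltW.
have [bPa /(_ (K + 1)^-1)[|b [bb [t t0 bt]] ab]] :=
  (roeP _ _ _).1 (iso_roe iso Aa); first by rewrite invr_gt0; lra.
have [x xt] := far (Num.truncn t).+1.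
have tx : t < dd (s x) (s (p x)) by apply: lt_le_trans xt; rewrite truncnS_gt.
pose X := proj e (p x) \o (a \o proj e x).
pose Y := proj f (s (p x)) \o (Phi a \o proj f (s x)).
have Ax := roe_proj e_basis d_metric x.
have Apx := roe_proj e_basis d_metric (p x).
have Aax := roe_comp e_basis d_metric Aa Ax.
have AX : uniform_roe_algebra d e X by exact: roe_comp.
have [_ mul] := iso_hom iso.
have XY : Phi X = Y by rewrite /X (mul _ _ Apx Aax) (mul _ _ Aa Ax) !sP.
(* The band operator [b] has no entry from [s x] to [s (p x)], so subtracting it leaves the block
   unchanged. *)
have YE v : Y v = proj f (s (p x)) (Phi a (proj f (s x) v) - b (proj f (s x) v)).
  rewrite /proj coordB// [in RHS](_ : coord f (s (p x)) (b _) = 0) ?subr0//.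
  have [lb _] := bb.
  by rewrite (opZ lb) coordZ// bt// mulr0.
have Yle : opnorm Y <= P * P * (K + 1)^-1.
  have V0 : 0 <= (K + 1)^-1 by rewrite invr_ge0; lra.
  apply: opnorm_le => [|v]; first by rewrite !mulr_ge0.
  rewrite YE; apply: le_trans (fP _ _) _.
  have := ler_wpM2l P0 (ab (proj f (s x) v)).
  have := ler_wpM2l (mulr_ge0 P0 V0) (fP (s x) v); lra.
have Xe : X (e x) = e (p x).
  rewrite /X/= proj_basis// eqxx scale1r ae proj_basis// eqxx scale1r//.
have ex0 := nrm_gt0 (@basis_neq0 _ _ _ e_basis x).
have bX : bounded_operators X by case: AX.
(* [X] sends [e x] to [e (p x)], and since [p] is an involution, [e x] has norm at most [lambda]
   times that of [e (p x)]. *)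
have Xge : 1 <= lambda * opnorm X.
  have := nrm_opnorm (e x) bX; rewrite Xe => pxle.
  have := el (p x); rewrite pK => xle.
  rewrite -(ler_pM2r ex0) mul1r; apply: le_trans xle _.
  by rewrite -mulrA ler_wpM2l// ltW.
have XleY : opnorm X <= `|C| * opnorm Y.
  rewrite -(isoK iso AX) XY; apply: le_trans (CP _ _) _.
    by rewrite -XY; exact: (iso_roe iso).
  by rewrite ler_wpM2r ?opnorm_ge0// ler_norm.
have : 1 <= K / (K + 1).
  have -> : K / (K + 1) = lambda * `|C| * (P * P * (K + 1)^-1) by rewrite mulrA.
  have lC : 0 <= lambda * `|C| by rewrite mulr_ge0// ltW.
  apply: le_trans Xge _; apply: le_trans (ler_wpM2l lC Yle).
  by rewrite -mulrA ler_wpM2l// ltW.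
by rewrite ler_pdivlMr; lra.
Qed.

(** Contrapositive of coarseness of the inverse; [q + 1] turns the weak bound [q] on the image
    distance into the strict one required. *)
Lemma expanding_of_coarse (R : realType) (d dd : nat -> nat -> R) (s t : nat -> nat) :
  cancel s t -> coarse dd d t -> expanding d dd s.
Proof.
move=> sK t_coarse q q0; have [|r r0 rP] := t_coarse (q + 1); first lra.
exists r => // x y xy; rewrite ltNge; apply/negP => sxy.
by have := rP (s x) (s y); rewrite !sK => /(_ _); lra.
Qed.

Theorem theorem1p3 (R : realType) (d dd : nat -> nat -> R)
    (E F : completeNormedModType R[i]) (e : nat -> E) (f : nat -> F)
    (d_metric : is_metric d) (dd_metric : is_metric dd)
    (d_ulf : uniformly_locally_finite d)
    (dd_ulf : uniformly_locally_finite dd)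
    (e_symmetric : symmetric_basis e) (f_symmetric : symmetric_basis f)
    (iso : exists Phi : (E -> E) -> (F -> F),
       banach_algebra_iso
         (uniform_roe_algebra d e) (uniform_roe_algebra dd f) Phi /\
       order_iso e f
         (uniform_roe_algebra d e) (uniform_roe_algebra dd f) Phi) :
  bijectively_coarsely_equivalent d dd.
Proof.
have e_basis := e_symmetric.1; have f_basis := f_symmetric.1.
case: iso => Phi [alg ord].
have iso := ordered_roe_iso_pinv d_metric dd_metric e_basis f_basis alg ord.
have [s [t [sK tK sP tP]]] :=
  iso_index_bijection e_basis f_basis d_metric dd_metric iso.
exists s; first by exists t.
split.
  split; first exact: iso_index_coarse iso sP.
  apply: (expanding_of_coarse sK).
  exact: iso_index_coarse (ordered_roe_iso_sym iso) tP.
have [ddge dd0 _ _] := dd_metric.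
(* Each [y] equals [s (t y)], so its distance to the range of [s] is at most 0. *)
exists 0 => _ [y _ <-]; apply: ge_inf; first by exists 0 => _ [x _ <-].
by exists (t y) => //; rewrite tK; apply/dd0.
Qed.
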